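(* Let $n\ge 2w\ge 2$ and $e\ge 2$ be integers, and let $\Phi_e(n,w)=\sum_{i=0}^{e}\binom{w}{i}\binom{n-w}{i}$. If $\Phi_e(n,w)\equiv 0\pmod{p^2}$ for some prime $p$, then no nontrivial $e$-perfect code exists in $J(n,w)$.
   Context: The Johnson scheme $J(n,w)$ has as elements all $w$-subsets of $[n]=\{1,\dots,n\}$, with distance $d(X,Y)=|X\setminus Y|$. The $e$-ball centred at $X$ is the set of $w$-subsets at distance at most $e$ from $X$; its size is $\Phi_e(n,w)$. An $e$-perfect code in $J(n,w)$ is a set $\mathcal C$ of $w$-subsets such that the $e$-balls centred at the elements of $\mathcal C$ partition the set of all $w$-subsets of $[n]$. It is trivial if $e=0$, or $|\mathcal C|=1$, or $n=2w$, $w=2e+1$ and $\mathcal C$ consists of a $w$-subset and its complement; otherwise it is nontrivial. *)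

(* Defs.v *)
From mathcomp Require Import all_boot.

Set Implicit Arguments.
Unset Strict Implicit.
Unset Printing Implicit Defensive.

Definition johnson (n w : nat) : {set {set 'I_n}} :=
  [set X : {set 'I_n} | #|X| == w].

Definition jdist (n : nat) (X Y : {set 'I_n}) : nat := #|X :\: Y|.

Definition jball (n w e : nat) (X : {set 'I_n}) : {set {set 'I_n}} :=
  [set Y in johnson n w | jdist X Y <= e].

(* The balls form a partition as a family indexed by C. This is not
   [partition (jball w e @: C) (johnson n w)], which would identify equal
   balls around distinct centres (as happens when w <= e). *)
Definition perfect_code (n w e : nat) (C : {set {set 'I_n}}) : Prop :=
  [/\ C \subset johnson n w,
      {in C &, forall X Y, X != Y -> [disjoint jball w e X & jball w e Y]}
    & \bigcup_(X in C) jball w e X = johnson n w].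

Definition trivial_code (n w e : nat) (C : {set {set 'I_n}}) : Prop :=
  [\/ e = 0, #|C| = 1
    | [/\ n = 2 * w, w = 2 * e + 1
        & exists2 X, X \in johnson n w & C = [set X; ~: X]]].

Definition Phi (e n w : nat) : nat :=
  \sum_(0 <= i < e.+1) 'C(w, i) * 'C(n - w, i).

(* Main.v *)
Require Import Defs.
From mathcomp Require Import all_boot all_order all_algebra.
From mathcomp Require Import zify ring lra.

(** The idea is that a nontrivial perfect code is a [t]-design for every
[t < w / 2], and that a suitable [t] makes the resulting divisibility condition
incompatible with [p^2 %| Phi].

If every [t]-set lies in equally many codewords, then [Phi] divides
[C(n - t, w - t)] ([Phi_cover_count]). Let [p ^ s] be the largest power of [p] that
is at most [w], and take [t = w mod p ^ s], which is less than [w / 2]. Then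
[w - t] is a multiple of [p ^ s], and [n - t < p ^ (s + 2)] because [n < 5 w / 2] by
Roos' bound ([roos_bound]). Hence at most one carry occurs in the base-[p] addition
of [w - t] and [n - w], so [p^2] does not divide [C(n - t, w - t)]
([logn_bin_le1]).

The design property ([perfect_design]) is proved by induction on [t]. The words that
contain a [t]-set [T] are partitioned by the balls, and the number of them in the
ball around [X] is a polynomial of degree at most [t] in [#|X :&: T|], whose top
Newton coefficient is the [t]-th eigenvalue of the ball in the Johnson scheme. If
that eigenvalue is not zero, the number of codewords through [T] is determined by
the numbers for smaller sets. The eigenvalue satisfies a three-term recurrence in
the radius ([johnson_eigen_rec]), and the recurrence shows that it is positive for
all [0 < t < w / 2], provided that [w] is at least about [16 e]
([johnson_eigen_half_gt0]).

This lower bound on [w] is where nontriviality enters. If [w = 2 e + 1] the code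
is trivial ([nontrivial_weight]). Otherwise the codewords at distance [2 e + 1] from
a given one yield a Steiner system S(e+1, 2e+1, w) ([code_steiner]), so that
[w >= (e + 1) (e + 2)] by Tits' bound ([tits_bound]); together with the divisibility
conditions for Steiner systems this is enough ([steiner_arith]). *)

Set Implicit Arguments.
Unset Strict Implicit.
Unset Printing Implicit Defensive.
Import Order.TTheory GRing.Theory Num.Theory.

(** * Eigenvalues of balls in the Johnson scheme *)

Section Eigenvalues.
Local Open Scope ring_scope.

Local Notation u := ('X : {poly {poly int}}).
Local Notation v := ('X%:P : {poly {poly int}}).

(** The coefficient of [u^i v^i]: words at distance [i] from a codeword arise by
adding [i] points, marked by [u], and removing [i] points, marked by [v]. *)
Definition diag (g : {poly {poly int}}) (i : nat) : int := g`_i`_i.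

Lemma coef_XD1_exp (R : nzRingType) n i :
  (('X + 1 : {poly R}) ^+ n)`_i = 'C(n, i)%:R.
Proof.
rewrite exprD1n coef_sum.
under eq_bigr => j _ do rewrite coefMn coefXn.
have [lt_in|le_ni] := ltnP i n.+1.
  rewrite (bigD1 (Ordinal lt_in)) //= eqxx big1 ?addr0 // => j ne_ji.
  rewrite (_ : (i == j) = false) ?mul0rn //; apply: contraNF ne_ji => /eqP eq_ij.
  exact/eqP/val_inj.
rewrite bin_small // big1 // => j _.
by rewrite (_ : (i == j) = false) ?mul0rn //; apply/negP => /eqP; move: (ltn_ord j); lia.
Qed.

Lemma coef_bin2 A B i j :
  ((u + 1) ^+ A * (v + 1) ^+ B)`_i`_j = ('C(A, i) * 'C(B, j))%:R :> int.
Proof.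
have -> : (v + 1) ^+ B = (('X + 1) ^+ B)%:P :> {poly {poly int}}.
  by rewrite polyC_exp polyCD polyC1.
by rewrite coefMC coef_XD1_exp mulr_natl coefMn coef_XD1_exp -mulrnA mulnC.
Qed.

Lemma diagMn g m i : diag (g *+ m) i = diag g i *+ m.
Proof. by rewrite /diag !coefMn. Qed.

Lemma diag_sum (I : Type) (r : seq I) (P : pred I) F i :
  diag (\sum_(j <- r | P j) F j) i = \sum_(j <- r | P j) diag (F j) i.
Proof. by rewrite /diag !coef_sum. Qed.

Lemma diag_mul1Buv g i :
  diag (g * (1 - u * v)) i = diag g i - (if i is j.+1 then diag g j else 0).
Proof.
rewrite mulrBr mulr1 mulrA /diag !coefB coefMC coefMX.
by case: i => [|i] /=; rewrite ?mul0r ?coef0 ?coefMX.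
Qed.

(** The factor [1 - u v] turns the sum over the spheres inside a ball into a
single coefficient, because the sum telescopes. *)
Lemma sum_diag_mul1Buv g e :
  \sum_(i < e.+1) diag (g * (1 - u * v)) i = diag g e.
Proof.
elim: e => [|e IHe]; rewrite big_ord_recr /= ?big_ord0 ?IHe diag_mul1Buv.
  by rewrite add0r subr0.
by rewrite addrC subrK.
Qed.

(** With [A = n - w - t], [B = w - t] and [s = t] this is the [t]-th eigenvalue of
the distance-[i] graph of the Johnson scheme J(n,w), an Eberlein polynomial.
The value that matters below is [s = t - 1]: it is the [t]-th eigenvalue of
the ball of radius [i]. *)
Definition johnson_eigen (A B s i : nat) : int :=
  diag ((u + 1) ^+ A * (v + 1) ^+ B * (1 - u * v) ^+ s) i.

Lemma johnson_eigenS A B s i :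
  johnson_eigen A B s.+1 i =
    johnson_eigen A B s i - (if i is j.+1 then johnson_eigen A B s j else 0).
Proof. by rewrite /johnson_eigen exprSr mulrA diag_mul1Buv. Qed.

Lemma johnson_eigen_s0 A B i :
  johnson_eigen A B 0 i = ('C(A, i) * 'C(B, i))%:R.
Proof. by rewrite /johnson_eigen expr0 mulr1 /diag coef_bin2. Qed.

Lemma johnson_eigen_i0 A B s : johnson_eigen A B s 0 = 1.
Proof.
elim: s => [|s IHs]; first by rewrite johnson_eigen_s0 !bin0.
by rewrite johnson_eigenS IHs subr0.
Qed.

Lemma mul_binS_int (n k : nat) :
  (k.+1%:R * 'C(n, k.+1)%:R = (n%:R - k%:R) * 'C(n, k)%:R :> int).
Proof.
have [le_kn|lt_nk] := leqP k n; last by rewrite !bin_small ?mulr0 //; lia.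
by rewrite -natrB // -!natrM mul_bin_left.
Qed.

(** The three-term recurrence of the Eberlein polynomials in the radius [i].
For [s = 0] it follows from [(k + 1) C(n,k+1) = (n - k) C(n,k)]. The identity for
[s.+1] and radius [i] is the difference of the identities for [s] at the radii
[i] and [i - 1], since the eigenvalue for [s.+1] is such a difference. *)
Lemma johnson_eigen_rec A B s i :
  i.+1%:R ^+ 2 * johnson_eigen A B s i.+1 =
    (A%:R * B%:R - s%:R - i%:R * (A%:R + B%:R + 2 * s%:R - 2 * i%:R))
      * johnson_eigen A B s i
    - (A%:R + s%:R - i%:R + 1) * (B%:R + s%:R - i%:R + 1)
      * (if i is j.+1 then johnson_eigen A B s j else 0).
Proof.
elim: s i => [|s IHs] i.
  (* For s = 0 the recurrence has a first-order refinement. *)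
  have rec k : k.+1%:R ^+ 2 * johnson_eigen A B 0 k.+1 =
      (A%:R - k%:R) * (B%:R - k%:R) * johnson_eigen A B 0 k.
    rewrite !johnson_eigen_s0 !natrM.
    have := mul_binS_int A k; have := mul_binS_int B k.
    move: ('C(A, k.+1)%:R) ('C(B, k.+1)%:R) => a b hb ha.
    rewrite (_ : _ * (a * b) = k.+1%:R * a * (k.+1%:R * b)); last by ring.
    by rewrite ha hb; ring.
  case: i => [|i]; rewrite rec; first by ring.
  have rec_i := rec i.
  rewrite (_ : _ * johnson_eigen A B 0 i =
    i.+1%:R ^+ 2 * johnson_eigen A B 0 i.+1); first by ring.
  by rewrite rec_i; ring.
rewrite !johnson_eigenS mulrBr IHs.
case: i => [|[|i]].
- by rewrite johnson_eigen_i0 -natr1; ring.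
- have := IHs 0%N; rewrite !johnson_eigenS johnson_eigen_i0 -natr1 => h.
  move: h; rewrite -[s.+1%:R]natr1; move: (johnson_eigen A B s 1) => x h.
  have -> : x = A%:R * B%:R - s%:R.
    apply/eqP; rewrite -subr_eq0; apply/eqP; move/eqP: h; rewrite -subr_eq0 => /eqP h.
    by rewrite -[RHS]h; ring.
  ring.
- have := IHs i.+1; rewrite !johnson_eigenS -[s.+1%:R]natr1.
  rewrite -[i.+3%:R]natr1 -[i.+2%:R]natr1 -[i.+1%:R]natr1.
  move: (johnson_eigen A B s i.+2) (johnson_eigen A B s i.+1).
  move: (johnson_eigen A B s i) => x y z h.
  apply/eqP; rewrite -subr_eq0; apply/eqP.
  move/eqP: h; rewrite -subr_eq0 => /eqP h.
  rewrite -[RHS]oppr0 -h /=; ring.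
Qed.
End Eigenvalues.

Section Positivity.
Local Open Scope ring_scope.

(** Here [theta] is the [s]-th eigenvalue of the distance-1 graph of J(N,B+s). The
recurrence keeps the ratio [F (i + 1) / F i] above [N / (2 (i + 1))] as long as [theta] is at
least [(4 i + 1) N / 2], since the coefficient of [F (i - 1)] is at most
[N^2 / 4]. The ratio is needed for [i <= e - 2] only, which gives the first bound
on [theta]; after that [F e] only has to be positive, which gives the second one,
the stronger of the two for [e <= 3]. *)
Lemma johnson_eigen_gt0 (A B s e : nat) :
  let N : int := A%:R + B%:R + 2 * s%:R in
  let theta : int := A%:R * B%:R - s%:R in
  (2 <= e)%N -> e%:R <= N ->
  (4 * e%:R - 7) * N < 2 * theta -> 3 * (e%:R - 1) * N < 2 * theta ->
  0 < johnson_eigen A B s e.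
Proof.
move=> N theta le2e le_eN lt1 lt2.
pose F := johnson_eigen A B s.
have step i : (i.+1 < e)%N -> 0 < F i -> N * F i <= 2 * i.+1%:R * F i.+1 ->
    0 < F i.+1 /\ (2 * theta - 3 * i.+1%:R * N) * F i.+1 <= 2 * (i.+2%:R ^+ 2 * F i.+2).
  move=> lt_ie Fi_gt0 le_F.
  have N_gt0 : 0 < N by lia.
  have Fi1_gt0 : 0 < F i.+1.
    have : 0 < 2 * i.+1%:R * F i.+1 by apply: lt_le_trans le_F; exact: mulr_gt0.
    by rewrite pmulr_rgt0 // mulr_gt0.
  split=> //.
  have := johnson_eigen_rec A B s i.+1; rewrite -/(F i.+2) -/(F i.+1) -/(F i).
  move=> ->.
  rewrite (_ : _ - _ - _ = theta - i.+1%:R * N + 2 * i.+1%:R ^+ 2) //; last first.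
    by rewrite /theta /N; ring.
  (* 4 x y <= (x + y)^2, and the sum x + y is N - 2 i. *)
  have le_b : 4 * ((A%:R + s%:R - i.+1%:R + 1) * (B%:R + s%:R - i.+1%:R + 1)) <= N ^+ 2.
    have hi : i.+1%:R = i%:R + 1 :> int by rewrite natr1.
    have le_iN : i%:R <= N by lia.
    rewrite hi /N; rewrite /N in le_iN.
    have i_ge0 : 0 <= i%:R :> int by [].
    have : 0 <= i%:R * (A%:R + B%:R + 2 * s%:R - i%:R) :> int by apply: mulr_ge0 => //; lia.
    have := sqr_ge0 (A%:R - B%:R : int); nra.
  set b := (X in 4 * X) in le_b *.
  have le_bF : 4 * (b * F i) <= N * (2 * i.+1%:R * F i.+1).
    apply: (@le_trans _ _ (N * (N * F i))).
      rewrite (mulrA N) -expr2 (mulrA 4); apply: ler_wpM2r le_b; exact: ltW.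
    by apply: ler_wpM2l => //; exact: ltW.
  have : 0 <= i.+1%:R ^+ 2 * F i.+1 by apply: mulr_ge0; rewrite ?sqr_ge0 // ltW.
  move: le_bF; move: (i.+1%:R : int) (b * F i) (F i.+1) => x y z; lra.
have main i : (i.+1 < e)%N -> 0 < F i /\ N * F i <= 2 * i.+1%:R * F i.+1.
  have N_ge0 : 0 <= N by lia.
  have theta_ge0 : 0 <= theta by nia.
  elim: i => [|i IHi] lt_ie.
    have := johnson_eigen_rec A B s 0; rewrite -/(F 1%N) -/(F 0%N) /F !johnson_eigen_i0.
    split=> //; nia.
  have [|F_gt0 le_F] := IHi; first by lia.
  have [F1_gt0 le_F1] := step i (ltnW lt_ie) F_gt0 le_F; split=> //.
  have : (i.+2%:R : int) * (N * F i.+1) <= i.+2%:R * (2 * i.+2%:R * F i.+2).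
    apply: le_trans (_ : (2 * theta - 3 * i.+1%:R * N) * F i.+1 <= _); last first.
      by apply: le_trans le_F1 _; rewrite expr2; lra.
    rewrite mulrA; apply: ler_wpM2r; first exact: ltW.
    have : (4 * i%:R + 5) * N <= (4 * e%:R - 7) * N by apply: ler_wpM2r => //; lia.
    rewrite -[i.+2%:R]natr1 -[i.+1%:R]natr1; lra.
  by rewrite ler_pM2l.
case: e le2e le_eN lt1 lt2 step main => [|[|i]] // _ le_eN lt1 lt2 step main.
have [F_gt0 le_F] := main i (leqnn _).
have [F1_gt0 le_F1] := step i (leqnn _) F_gt0 le_F.
have : 0 < 2 * (i.+2%:R ^+ 2 * F i.+2).
  apply: lt_le_trans le_F1; apply: mulr_gt0 => //; rewrite subr_gt0.
  by apply: le_lt_trans lt2; rewrite -[i.+2%:R]natr1 addrK.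
by rewrite !pmulr_rgt0 // exprn_gt0.
Qed.

(** For [2 t < w] the eigenvalue [theta] is about [w^2 / 4] or more, whereas the
bound required above is about [4 e w]; hence a lower bound on [w] near [16 e]
is what is needed. *)
Lemma johnson_eigen_half_gt0 n w e t :
  (2 <= e)%N -> (2 * w <= n)%N -> (0 < t)%N -> (2 * t < w)%N ->
  (16 * e - 29 <= w)%N -> (12 * e - 13 <= w)%N ->
  0 < johnson_eigen (n - w - t) (w - t) t.-1 e.
Proof.
move=> le2e le_wn t_gt0 lt_tw le1 le2.
have [a ->] : exists a, n = (a + 2 * w)%N by exists (n - 2 * w)%N; lia.
have [B def_w] : exists B, w = (B + t)%N by exists (w - t)%N; lia.
have [s def_t] : exists s, t = s.+1 by case: t t_gt0 {lt_tw def_w} => // t; exists t.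
rewrite (_ : a + 2 * w - w - t = a + B)%N; last by lia.
rewrite (_ : w - t = B)%N; last by lia.
rewrite def_t /=; apply: johnson_eigen_gt0 => //; nia.
Qed.
End Positivity.

(** * Binomial coefficients with small p-adic valuation *)

Lemma logn_fact_wide p n m : prime p -> n <= m ->
  logn p n`! = \sum_(1 <= k < m.+1) n %/ p ^ k.
Proof.
move=> p_pr le_nm; rewrite logn_fact // (@big_cat_nat _ _ _ n.+1 1 m.+1) //=.
rewrite [X in _ = _ + X]big_nat_cond [X in _ = _ + X]big1 ?addn0 // => k.
rewrite andbT => /andP[lt_nk _]; apply: divn_small.
exact: leq_trans lt_nk (ltnW (ltn_expl _ (prime_gt1 p_pr))).
Qed.

(** By Legendre's formula the valuation counts the carries when [l] and [m - l] are
added in base [p]. There is no carry below position [s], as [l] has only zero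
digits there, and none out of position [s + 1], as the sum is less than
[p ^ s.+2]. Only the carry out of position [s] remains. *)
Lemma logn_bin_le1 p s l m : prime p -> l <= m -> p ^ s %| l -> m < p ^ s.+2 ->
  logn p 'C(m, l) <= 1.
Proof.
move=> p_pr le_lm dvd_l lt_m.
have p_gt0 := prime_gt0 p_pr.
have := congr1 (logn p) (bin_fact le_lm).
rewrite !lognM ?muln_gt0 ?fact_gt0 ?bin_gt0 //.
rewrite (@logn_fact_wide p l m) // (@logn_fact_wide p (m - l) m) ?leq_subr //.
rewrite (@logn_fact_wide p m m) //= -big_split /= => def_log.
suff : \sum_(1 <= k < m.+1) m %/ p ^ k <=
    1 + \sum_(1 <= k < m.+1) (l %/ p ^ k + (m - l) %/ p ^ k) by lia.
apply: leq_trans (_ : \sum_(1 <= k < m.+1)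
    ((k == s.+1) + (l %/ p ^ k + (m - l) %/ p ^ k)) <= _).
  apply: leq_sum => k _; have [le_ks|lt_sk|->] /= := ltngtP k s.+1.
  - by rewrite -{1}(subnKC le_lm) divnDl // (dvdn_trans _ dvd_l) // dvdn_exp2l.
  - by rewrite divn_small // (leq_trans lt_m) // leq_pexp2l.
  - by rewrite -{1}(subnKC le_lm) [leqRHS]addnC leq_divDl.
rewrite big_split leq_add2r -big_mkcond /= sum1_count -/(count_mem _ _).
by rewrite count_uniq_mem ?iota_uniq // leq_b1.
Qed.

(** * Counting sets with prescribed intersections *)

Section Counting.

Definition draws (T : finType) (A : {set T}) (k : nat) : {set {set T}} :=
  [set D : {set T} | D \subset A & #|D| == k].

Lemma double_counting (S T : finType) (A : {set S}) (B : {set T}) (r : S -> T -> bool) :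
  \sum_(x in A) #|[set y in B | r x y]| = \sum_(y in B) #|[set x in A | r x y]|.
Proof.
transitivity (\sum_(x in A) \sum_(y in B) (r x y : nat)).
  by apply: eq_bigr => x _; rewrite -sum1dep_card big_mkcondr.
rewrite exchange_big; apply: eq_bigr => y _.
by rewrite -sum1dep_card [RHS]big_mkcondr.
Qed.

(** A set is determined by its traces on [K], on [L] and outside [K :|: L], and these
can be prescribed independently. All the counts of words below reduce to this
one. *)
Lemma card_cut2 (T : finType) (P K L : {set T}) i j :
  [disjoint P & K] -> [disjoint P & L] -> [disjoint K & L] ->
  #|[set Y : {set T} | [&& Y :\: (K :|: L) == P, #|Y :&: K| == i & #|Y :&: L| == j]]|
    = 'C(#|K|, i) * 'C(#|L|, j).
Proof.
move=> dPK dPL dKL.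
rewrite -(cards_draws K) -(cards_draws L) -cardsX -/(draws K i) -/(draws L j).
have cap0 (A B D E : {set T}) : [disjoint A & B] -> D \subset A -> E \subset B ->
    D :&: E = set0.
  move=> dAB sDA sEB; apply/eqP; rewrite setI_eq0.
  exact: disjointWl sDA (disjointWr sEB dAB).
have restr (D E : {set T}) : D \subset K -> E \subset L ->
   [/\ (P :|: D :|: E) :\: (K :|: L) = P, (P :|: D :|: E) :&: K = D
     & (P :|: D :|: E) :&: L = E].
  move=> sDK sEL; split.
  - rewrite !setDUl !setDUr (setDidPl _) // (setDidPl _) // setIid.
    have -> : D :\: K = set0 by apply/eqP; rewrite setD_eq0.
    have -> : E :\: L = set0 by apply/eqP; rewrite setD_eq0.
    by rewrite set0I setI0 !setU0.
  - rewrite !setIUl (cap0 _ _ _ _ dPK) // set0U (setIidPl sDK).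
    by rewrite setIC (cap0 _ _ _ _ dKL) // setU0.
  - by rewrite !setIUl (cap0 _ _ _ _ dPL) // (cap0 _ _ _ _ dKL) // !set0U (setIidPl sEL).
pose f (DE : {set T} * {set T}) := P :|: DE.1 :|: DE.2.
have inj_f : {in setX (draws K i) (draws L j) &, injective f}.
  move=> [D E] [D' E'] /setXP[/setIdP[/= sD _] /setIdP[sE _]].
  move=> /setXP[/setIdP[/= sD' _] /setIdP[sE' _]]; rewrite /f /= => eqf.
  have [_ eD eE] := restr _ _ sD sE; have [_ eD' eE'] := restr _ _ sD' sE'.
  by congr (_, _); [rewrite -eD eqf eD'|rewrite -eE eqf eE'].
rewrite -(card_in_imset inj_f); apply: eq_card => Y; rewrite inE.
apply/and3P/imsetP => [[/eqP eqP cK cL]|[[D E] /setXP[/setIdP[/= sD cD] /setIdP[sE cE]] ->]].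
  exists (Y :&: K, Y :&: L); first by rewrite !inE !subsetIr cK cL.
  by rewrite /f /= -eqP -setUA -setIUr setUC setID.
by have [-> -> ->] := restr _ _ sD sE.
Qed.

Lemma card_supersets (T : finType) (U V : {set T}) k : U \subset V ->
  #|[set Y : {set T} | [&& U \subset Y, Y \subset V & #|Y| == #|U| + k]]| =
    'C(#|V| - #|U|, k).
Proof.
move=> sUV; have dU : [disjoint U & V :\: U] by rewrite disjoints_subset setCD subsetUr.
have d0 (A : {set T}) : [disjoint A & set0] by rewrite -setI_eq0 setI0.
have := @card_cut2 T U (V :\: U) set0 k 0 dU (d0 _) (d0 _).
rewrite cards0 bin0 muln1 cardsDS // => <-.
apply: eq_card => Y; rewrite !inE setU0 setI0 cards0 eqxx andbT.
apply/and3P/andP => [[sUY sYV /eqP cY]|[/eqP eqU /eqP cY]].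
  split; last by rewrite setIDA (setIidPl sYV) cardsDS // cY addKn.
  have YDV : Y :\: V = set0 by apply/eqP; rewrite setD_eq0.
  by rewrite setDDr YDV set0U (setIidPr sUY).
have sUY : U \subset Y by rewrite -eqU subsetDl.
have sYV : Y \subset V.
  rewrite -(setID Y (V :\: U)) eqU subUset sUV andbT.
  by rewrite (subset_trans (subsetIr _ _)) ?subsetDl.
split=> //; move: cY; rewrite setIDA (setIidPl sYV) cardsDS // => <-.
by rewrite subnKC // subset_leq_card.
Qed.

Lemma exists_subset_card (T : finType) (A : {set T}) k : k <= #|A| ->
  exists2 D : {set T}, D \subset A & #|D| = k.
Proof.
rewrite -bin_gt0 -cards_draws card_gt0 => /set0Pn[D].
by rewrite inE => /andP[sDA /eqP cD]; exists D.
Qed.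

End Counting.

(** * Supersets of a given set inside a ball *)

Section Regularity.
Local Open Scope ring_scope.
Local Notation u := ('X : {poly {poly int}}).
Local Notation v := ('X%:P : {poly {poly int}}).

(** Coefficients of the Newton expansion, in the variable [m = #|X :&: T|], of the
number of supersets of [T] in the ball of radius [e] around [X]. *)
Definition newton_coef (A B e t j : nat) : int :=
  \sum_(i < e.+1) diag ((u + 1) ^+ A * (v + 1) ^+ B * (1 - u * v) ^+ j
                          * (u * (v + 1)) ^+ (t - j)) i.

Lemma newton_coef_top A B e t : (0 < t)%N ->
  newton_coef A B e t t = johnson_eigen A B t.-1 e.
Proof.
case: t => // t _; rewrite /newton_coef /johnson_eigen -sum_diag_mul1Buv.
by apply: eq_bigr => i _; rewrite subnn expr0 mulr1 exprSr mulrA.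
Qed.

(** The number of supersets of [T] at distance [i] from [X] is the coefficient of
[u^i v^i] in [u^(t-m) (1+u)^(A+m) (1+v)^(B+t-m)]. Writing
[1 + u = (1 - u v) + u (1 + v)] in the power with exponent [m] and expanding
gives its Newton expansion in [m]. *)
Lemma sphere_gf A B t m i : (m <= t)%N ->
  (if (t - m <= i)%N then 'C(A + m, i - (t - m)) * 'C(B + t - m, i) else 0)%N%:R =
  \sum_(j < t.+1) 'C(m, j)%:R *
    diag ((u + 1) ^+ A * (v + 1) ^+ B * (1 - u * v) ^+ j * (u * (v + 1)) ^+ (t - j)) i.
Proof.
move=> le_mt.
transitivity (diag ((u + 1) ^+ (A + m) * (v + 1) ^+ (B + t - m) * u ^+ (t - m)) i).
  rewrite /diag coefMXn ltnNge; case: ifP => le_i /=; last by rewrite coef0.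
  by rewrite coef_bin2.
have -> : (u + 1) ^+ (A + m) * (v + 1) ^+ (B + t - m) * u ^+ (t - m) =
   (u + 1) ^+ A * (v + 1) ^+ B * (u * (v + 1)) ^+ (t - m) * (u * (v + 1) + (1 - u * v)) ^+ m.
  rewrite (_ : u * (v + 1) + _ = u + 1); last by ring.
  by rewrite -addnBA // !exprD exprMn; ring.
rewrite (exprDn (u * (v + 1))) mulr_sumr diag_sum.
rewrite (big_ord_widen_cond t.+1 xpredT (fun j => diag ((u + 1) ^+ A * (v + 1) ^+ B *
   (u * (v + 1)) ^+ (t - m) * ((u * (v + 1)) ^+ (m - j) * (1 - u * v) ^+ j *+ 'C(m, j))) i)) //.
rewrite big_mkcond; apply: eq_bigr => j _ /=; rewrite ltnS.
have [le_jm|lt_mj] := leqP j m; last by rewrite bin_small // mul0r.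
rewrite mulr_natl -diagMn; congr (diag _ i).
rewrite mulrnAr; congr (_ *+ _).
rewrite (_ : t - j = (t - m) + (m - j))%N; last by lia.
rewrite exprD; ring.
Qed.

(** The number of supersets of [T] in a ball depends only on the size [m] of the
intersection of [T] with the centre, and is a polynomial of degree at most [#|T|]
in [m]. Its top coefficient is the eigenvalue of the ball in [newton_coef_top]. *)
Lemma card_ball_supersets n w e (X T : {set 'I_n}) :
  #|X| = w -> (#|T| <= w)%N -> (#|T| + w <= n)%N ->
  #|[set Y in jball w e X | T \subset Y]|%:R =
    \sum_(j < #|T|.+1) 'C(#|X :&: T|, j)%:R *
       newton_coef (n - w - #|T|) (w - #|T|) e #|T| j :> int.
Proof.
move=> cX le_tw le_tn; set t := #|T|; set m := #|X :&: T|.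
have le_mt : (m <= t)%N by rewrite subset_leq_card ?subsetIr.
have le_mw : (m <= w)%N by rewrite -cX subset_leq_card ?subsetIl.
have cK : #|X :\: T| = (w - m)%N by rewrite cardsD cX.
have cL : #|~: (X :|: T)| = (n - w - t + m)%N.
  by have := cardsC (X :|: T); rewrite cardsU card_ord cX -/m -/t; lia.
have cardY (Y : {set 'I_n}) : T \subset Y ->
   #|Y| = (t + #|Y :&: (X :\: T)| + #|Y :&: ~: (X :|: T)|)%N.
  move=> sTY; have h1 := cardsID X (Y :\: T); have h2 := cardsID T Y.
  rewrite (setIidPr sTY) in h2; rewrite -h2 -h1 addnA.
  have -> : Y :&: (X :\: T) = (Y :\: T) :&: X.
    by apply/setP=> x; rewrite !inE; do !case: (_ \in _).
  have -> // : Y :&: ~: (X :|: T) = Y :\: T :\: X.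
  by apply/setP=> x; rewrite !inE; do !case: (_ \in _).
have cardXY (Y : {set 'I_n}) : T \subset Y ->
   (#|X :\: Y| + #|Y :&: (X :\: T)| = w - m)%N.
  move=> sTY; rewrite -cK -(cardsID Y (X :\: T)) setDDl (setUidPr sTY) addnC.
  by rewrite (setIC Y).
have sphere i : #|[set Y : {set 'I_n} | [&& #|Y| == w, jdist X Y == i & T \subset Y]]| =
  (if t - m <= i then 'C(n - w - t + m, i - (t - m)) * 'C(w - m, i) else 0)%N.
  have [le_i|lt_i] := leqP (t - m) i; last first.
    apply: eq_card0 => Y; rewrite !inE; apply/and3P=> -[/eqP cY /eqP dY sTY].
    by have := cardY Y sTY; have := cardXY Y sTY; rewrite cY [#|X :\: Y|]dY; lia.
  have [le_iw|lt_wi] := leqP i (w - m); last first.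
    rewrite [X in (_ * X)%N]bin_small // muln0.
    apply: eq_card0 => Y; rewrite !inE; apply/and3P=> -[/eqP cY /eqP dY sTY].
    by have := cardXY Y sTY; rewrite [#|X :\: Y|]dY; lia.
  rewrite mulnC -bin_sub // -cK -cL -(@card_cut2 _ T); first last.
  - rewrite disjoints_subset setCK setDE subIset ?subsetUl //.
  - by rewrite disjoints_subset setCK subsetUr.
  - by rewrite disjoints_subset setDE setCI setCK subsetUr.
  apply: eq_card => Y; rewrite !inE.
  have -> : (Y :\: (X :\: T :|: ~: (X :|: T)) == T) = (T \subset Y).
    rewrite setDE (_ : ~: _ = T); last first.
      by apply/setP=> x; rewrite !inE; case: (x \in X); case: (x \in T).
    by apply/eqP/idP => [<-|/setIidPr //]; rewrite subsetIl.
  have [sTY|] := boolP (T \subset Y); rewrite ?andbF //= andbT.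
  have := cardY Y sTY; have := cardXY Y sTY; rewrite /jdist.
  move: #|X :\: Y| #|Y :&: (X :\: T)| #|Y :&: ~: (X :|: T)| #|Y| => a b c d h1 h2.
  rewrite cK; apply/andP/andP => -[/eqP ? /eqP ?]; split; apply/eqP; lia.
have -> : #|[set Y in jball w e X | T \subset Y]| = (\sum_(i < e.+1)
   #|[set Y : {set 'I_n} | [&& #|Y| == w, jdist X Y == i & T \subset Y]]|)%N.
  rewrite -sum1_card (partition_big (fun Y => inord (jdist X Y) : 'I_e.+1) xpredT) //=.
  apply: eq_bigr => i _; rewrite -sum1_card; apply: eq_bigl => Y; rewrite !inE.
  apply/idP/and3P => [/andP[/andP[/andP[-> le_e] ->] /eqP <-]|[-> /eqP dY ->]].
    by rewrite inordK.
  by rewrite dY inord_val -ltnS ltn_ord eqxx.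
have eqB : (w - m = w - t + t - m)%N by rewrite subnK.
rewrite natr_sum /newton_coef.
under eq_bigr => i _ do rewrite sphere eqB sphere_gf //.
by rewrite exchange_big; apply: eq_bigr => j _; rewrite mulr_sumr.
Qed.

End Regularity.

(** * Perfect codes are designs *)

Definition cover_count (n : nat) (C : {set {set 'I_n}}) (S : {set 'I_n}) : nat :=
  #|[set X in C | S \subset X]|.

Lemma sum_cover_count n (C : {set {set 'I_n}}) T j :
  \sum_(S in draws T j) cover_count C S = \sum_(X in C) 'C(#|X :&: T|, j).
Proof.
rewrite /cover_count -(double_counting _ _ (fun X S : {set 'I_n} => S \subset X)).
apply: eq_bigr => X _; rewrite -cards_draws; apply: eq_card => S.
by rewrite !inE subsetI andbC andbA.
Qed.

Lemma in_johnson n w (X : {set 'I_n}) : (X \in johnson n w) = (#|X| == w).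
Proof. by rewrite inE. Qed.

Lemma card_johnson n w : #|johnson n w| = 'C(n, w).
Proof.
have := cards_draws [set: 'I_n] w; rewrite cardsT card_ord => <-.
by apply: eq_card => X; rewrite !inE subsetT.
Qed.

Lemma cover_count_johnson n w (S : {set 'I_n}) : #|S| <= w ->
  cover_count (johnson n w) S = 'C(n - #|S|, w - #|S|).
Proof.
move=> le_Sw; have := card_supersets (w - #|S|) (subsetT S).
rewrite cardsT card_ord => <-.
by apply: eq_card => Y; rewrite !inE subsetT subnKC // andbC.
Qed.

Lemma card_jball n w e (X : {set 'I_n}) : w <= n -> X \in johnson n w ->
  #|jball w e X| = Phi e n w.
Proof.
move=> le_wn; rewrite in_johnson => /eqP cX.
have := @card_ball_supersets n w e X set0 cX; rewrite cards0 add0n => /(_ isT le_wn).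
rewrite big_ord1 setI0 cards0 bin0 mul1r /newton_coef !subn0.
under [X in _ = X -> _]eq_bigr => i _ do rewrite !mulr1 /diag coef_bin2.
rewrite -natr_sum => /eqP; rewrite eqr_nat => /eqP eq_ball.
rewrite /Phi big_mkord.
under eq_bigr => i _ do rewrite mulnC.
by rewrite -eq_ball; apply: eq_card => Y; rewrite !inE sub0set andbT.
Qed.

Section PerfectCode.
Variables (n w e : nat) (C : {set {set 'I_n}}).
Hypothesis perfC : perfect_code w e C.

Lemma code_card X : X \in C -> #|X| = w.
Proof. by case: perfC => /subsetP sCJ _ _ /sCJ; rewrite in_johnson => /eqP. Qed.

Lemma perfect_unique (X Y Z : {set 'I_n}) :
  X \in C -> Y \in C -> Z \in jball w e X -> Z \in jball w e Y -> X = Y.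
Proof.
case: perfC => _ disjC _ XC YC ZX ZY; apply/eqP/contraT => neXY.
by have := disjC X Y XC YC neXY; rewrite disjoint_subset => /subsetP/(_ Z ZX); rewrite inE ZY.
Qed.

Lemma perfect_cover (Z : {set 'I_n}) : #|Z| = w -> exists2 X, X \in C & Z \in jball w e X.
Proof.
case: perfC => _ _ covC cZ; have : Z \in johnson n w by rewrite in_johnson cZ.
by rewrite -covC => /bigcupP[X]; exists X.
Qed.

Lemma sum_card_jball (Q : pred {set 'I_n}) :
  \sum_(X in C) #|[set Y in jball w e X | Q Y]| = #|[set Y in johnson n w | Q Y]|.
Proof.
transitivity (\sum_(X in C) #|[set Y in [set Y in johnson n w | Q Y] | Y \in jball w e X]|).
  apply: eq_bigr => X XC; apply: eq_card => Y; rewrite !inE.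
  by case: (#|Y| == w); case: (Q Y); rewrite ?andbT ?andbF.
rewrite double_counting -sum1_card; apply: eq_bigr => Y.
rewrite inE in_johnson => /andP[/eqP cY _].
have [X XC YX] := perfect_cover cY; rewrite -(cards1 X); apply: eq_card => X'.
rewrite inE [RHS]inE; apply/andP/eqP => [[X'C YX']|-> //].
exact: perfect_unique YX' YX.
Qed.

Lemma perfect_card : w <= n -> #|C| * Phi e n w = 'C(n, w).
Proof.
move=> le_wn; rewrite -card_johnson -sum_nat_const.
have -> : johnson n w = [set Y in johnson n w | xpredT Y].
  by apply/setP=> Y; rewrite inE andbT.
rewrite -sum_card_jball; apply: eq_bigr => X XC.
rewrite -(@card_jball n w e X) ?in_johnson ?code_card //.
by apply: eq_card => Y; rewrite [RHS]inE andbT.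
Qed.

(** If every [t]-set lies in equally many codewords, then dividing the count of
pairs (t-set, codeword) by the count of pairs (t-set, word) gives the share
[1 / Phi] of the words through a given [t]-set. *)
Lemma Phi_cover_count t (T : {set 'I_n}) : w <= n -> t <= w ->
  (forall S : {set 'I_n}, #|S| = t -> cover_count C S = cover_count C T) ->
  Phi e n w * cover_count C T = 'C(n - t, w - t).
Proof.
move=> le_wn le_tw constC.
have cD : #|draws [set: 'I_n] t| = 'C(n, t) by rewrite cards_draws cardsT card_ord.
have sumC : 'C(n, t) * cover_count C T = #|C| * 'C(w, t).
  rewrite -cD -!sum_nat_const.
  transitivity (\sum_(S in draws [set: 'I_n] t) cover_count C S).
    by apply: eq_bigr => S; rewrite inE => /andP[_ /eqP cS]; rewrite constC.
  by rewrite sum_cover_count; apply: eq_bigr => X XC; rewrite setIT code_card.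
have sumJ : 'C(n, t) * 'C(n - t, w - t) = 'C(n, w) * 'C(w, t).
  rewrite -cD -(card_johnson n w) -!sum_nat_const.
  transitivity (\sum_(S in draws [set: 'I_n] t) cover_count (johnson n w) S).
    by apply: eq_bigr => S; rewrite inE => /andP[_ /eqP cS]; rewrite cover_count_johnson ?cS.
  rewrite sum_cover_count; apply: eq_bigr => X.
  by rewrite setIT in_johnson => /eqP->.
apply/eqP; rewrite -(eqn_pmul2l (m := 'C(n, t))) ?bin_gt0 ?(leq_trans le_tw) //.
by rewrite sumJ mulnCA sumC -(perfect_card le_wn) -mulnA mulnCA mulnA.
Qed.

(** Each word that contains [T] lies in exactly one ball; the balls are counted with
[card_ball_supersets]. *)
Lemma newton_cover_count (T : {set 'I_n}) : #|T| <= w -> #|T| + w <= n ->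
  ('C(n - #|T|, w - #|T|)%:R =
    \sum_(j < #|T|.+1) (\sum_(S in draws T j) cover_count C S)%N%:R *
       newton_coef (n - w - #|T|) (w - #|T|) e #|T| j :> int)%R.
Proof.
move=> le_tw le_tn; rewrite -(cover_count_johnson le_tw) /cover_count.
rewrite -sum_card_jball natr_sum.
under eq_bigr => X XC do rewrite (card_ball_supersets e (code_card XC) le_tw le_tn).
rewrite exchange_big; apply: eq_bigr => j _ /=.
by rewrite sum_cover_count natr_sum mulr_suml.
Qed.

(** A perfect code is a [t]-design for every [t < w / 2]. In [newton_cover_count] the
terms with [j < t] are the same for all [t]-sets [T] by induction, so the
remaining term, the number of codewords through [T] times a nonzero eigenvalue,
is the same as well. *)
Lemma perfect_design t : 2 <= e -> 2 * w <= n -> 16 * e - 29 <= w ->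
  12 * e - 13 <= w -> 2 * t < w ->
  forall S T : {set 'I_n}, #|S| = t -> #|T| = t -> cover_count C S = cover_count C T.
Proof.
move=> le2e le_wn le1 le2; elim/ltn_ind: t => t IHt lt_tw S T cS cT.
have [t0|t_gt0] := posnP t.
  move: cS cT; rewrite t0 => /eqP; rewrite cards_eq0 => /eqP-> /eqP.
  by rewrite cards_eq0 => /eqP->.
have le_tw : t <= w by lia.
have le_tn : t + w <= n by lia.
have := newton_cover_count (T := S); have := newton_cover_count (T := T).
rewrite cS cT => /(_ le_tw le_tn) -> /(_ le_tw le_tn).
have sum_top (R : {set 'I_n}) : #|R| = t ->
    \sum_(Q in draws R t) cover_count C Q = cover_count C R.
  move=> cR; rewrite (_ : draws R t = [set R]) ?big_set1 //.
  apply/setP=> Q; rewrite !inE; apply/andP/eqP => [[sQR /eqP cQ]|->]; last by rewrite cR.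
  by apply/eqP; rewrite eqEcard sQR cR cQ /=.
rewrite !big_ord_recr /= !sum_top // newton_coef_top //.
have eigen_gt0 : (0 < johnson_eigen (n - w - t) (w - t) t.-1 e)%R.
  exact: johnson_eigen_half_gt0.
have -> : (\sum_(j < t) (\sum_(Q in draws T j) cover_count C Q)%N%:R *
    newton_coef (n - w - t) (w - t) e t j =
  \sum_(j < t) (\sum_(Q in draws S j) cover_count C Q)%N%:R *
    newton_coef (n - w - t) (w - t) e t j)%R.
  apply: eq_bigr => j _; congr (_%:R * _)%R.
  have [Q0 Q0T] : exists Q0, Q0 \in draws T j.
    by apply/set0Pn; rewrite -card_gt0 cards_draws cT bin_gt0 ltnW.
  have cQ0 : #|Q0| = j by move: Q0T; rewrite inE => /andP[_ /eqP].
  have sum_draws (R : {set 'I_n}) : #|R| = t ->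
      \sum_(Q in draws R j) cover_count C Q = 'C(t, j) * cover_count C Q0.
    move=> cR; have := cards_draws R j; rewrite cR => <-.
    rewrite -sum_nat_const; apply: eq_bigr => Q.
    rewrite inE => /andP[_ /eqP cQ].
    by apply: (IHt j) => //; move: (ltn_ord j); lia.
  by rewrite !sum_draws.
move/addrI => /esym eq_top; apply/eqP; rewrite -(eqr_nat int); apply/eqP.
by apply: (mulIf (lt0r_neq0 eigen_gt0)).
Qed.

End PerfectCode.

(** * Steiner systems *)

Section Steiner.
Variable T : finType.
Implicit Types (X U A P : {set T}) (Bl : {set {set T}}).

Definition steiner X t k Bl : Prop :=
  (forall P, P \in Bl -> P \subset X /\ #|P| = k) /\
  (forall A, A \subset X -> #|A| = t -> #|[set P in Bl | A \subset P]| = 1).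

(** The divisibility conditions for Steiner systems: count the [t]-sets between [U]
and [X] by the blocks that contain them. *)
Lemma steiner_degree X t k Bl U : steiner X t k Bl ->
    U \subset X -> #|U| <= t ->
  #|[set P in Bl | U \subset P]| * 'C(k - #|U|, t - #|U|) = 'C(#|X| - #|U|, t - #|U|).
Proof.
move=> [blk uniq_blk] sUX le_Ut.
pose As := [set A : {set T} | [&& U \subset A, A \subset X & #|A| == #|U| + (t - #|U|)]].
rewrite -(card_supersets _ sUX) -/As -sum_nat_const -[RHS]muln1 -sum_nat_const.
transitivity (\sum_(P in [set P in Bl | U \subset P]) #|[set A in As | A \subset P]|).
  apply: eq_bigr => P; rewrite inE => /andP[/blk[sPX cP] sUP].
  rewrite -cP -(card_supersets _ sUP); apply: eq_card => A; rewrite !inE.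
  case: (U \subset A) => //=; have [sAP|] := boolP (A \subset P); last by rewrite andbF.
  by rewrite (subset_trans sAP) // andbT.
rewrite double_counting; apply: eq_bigr => A; rewrite inE subnKC // => /and3P[sUA sAX /eqP cA].
rewrite -(uniq_blk A) //; apply: eq_card => P; rewrite !inE.
by have [sAP|] := boolP (A \subset P); rewrite ?andbF // (subset_trans sUA) ?andbT.
Qed.

Lemma steiner_uniq X t k Bl A P Q : steiner X t k Bl -> A \subset X -> #|A| = t ->
  P \in Bl -> Q \in Bl -> A \subset P -> A \subset Q -> P = Q.
Proof.
move=> [_ uniq_blk] sAX cA PB QB sAP sAQ.
have /eqP/cards1P[R defR] := uniq_blk _ sAX cA.
have : P \in [set R] by rewrite -defR inE PB.
have : Q \in [set R] by rewrite -defR inE QB.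
by rewrite !inE => /eqP-> /eqP->.
Qed.

Lemma steiner_exists X t k Bl A : steiner X t k Bl -> A \subset X -> #|A| = t ->
  exists2 P, P \in Bl & A \subset P.
Proof.
move=> [_ uniq_blk] sAX cA.
have /eqP/cards1P[R defR] := uniq_blk _ sAX cA.
have : R \in [set R] by rewrite inE.
by rewrite -defR inE => /andP[RB sAR]; exists R.
Qed.

(** Tits' bound. Take a block [P0], a [t]-subset [A] of it and a point [x] of [X]
outside it: no block contains [S = x |: A]. Each of the [t + 1] sets [S :\ y]
lies in a block [B y], and two such blocks cannot meet outside [S], for they
would share [t] points and coincide, hence contain [S]. So there are [t + 1]
pairwise disjoint sets [B y :\: S] of size [k - t] outside [S]. *)
Lemma tits_bound X t k Bl : steiner X t k Bl -> t <= k -> k < #|X| ->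
  t.+1 * (k - t).+1 <= #|X|.
Proof.
move=> stX le_tk lt_kX; have [blk _] := stX.
have [A sAX cA] : exists2 A : {set T}, A \subset X & #|A| = t.
  by apply: exists_subset_card; exact: leq_trans le_tk (ltnW lt_kX).
have [P0 P0B sAP0] := steiner_exists stX sAX cA.
have [sP0X cP0] := blk _ P0B.
have [x] : exists x, x \in X :\: P0.
  by apply/set0Pn; rewrite -card_gt0 cardsDS // cP0 subn_gt0.
rewrite inE => /andP[xP0 xX].
pose S := x |: A.
have cS : #|S| = t.+1 by rewrite cardsU1 cA (contra _ xP0) // => /(subsetP sAP0).
have sSX : S \subset X by rewrite subUset sub1set xX.
have notS Q : Q \in Bl -> ~~ (S \subset Q).
  move=> QB; apply: contra xP0; rewrite subUset sub1set => /andP[xQ sAQ].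
  by rewrite (steiner_uniq stX sAX cA P0B QB).
clearbody S.
have [B defB] : exists B : T -> {set T}, forall y, y \in S -> B y \in Bl /\ S :\ y \subset B y.
  have : forall y, exists P : {set T}, y \in S -> P \in Bl /\ S :\ y \subset P.
    move=> y; have [yS|] := boolP (y \in S); last by exists set0.
    have [||P PB sP] := @steiner_exists X t k Bl (S :\ y) stX; last by exists P.
      exact: subset_trans (subsetDl _ _) sSX.
    by have := cardsD1 y S; rewrite yS cS; case.
  by move=> /fin_all_exists[B defB]; exists B.
have notyB y : y \in S -> y \notin B y.
  move=> yS; have [BB sB] := defB y yS; apply: contra (notS _ BB) => yB.
  by rewrite -(setD1K yS) subUset sub1set yB.
have cBS y : y \in S -> #|[set z in X :\: S | z \in B y]| = k - t.
  move=> yS; have [BB sB] := defB y yS; have [sBX <-] := blk _ BB.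
  have -> : [set z in X :\: S | z \in B y] = B y :\: (S :\ y).
    apply/setP=> z; rewrite !inE; have [zB|] := boolP (z \in B y); rewrite ?andbF // !andbT.
    rewrite (subsetP sBX _ zB) andbT; have [eq_zy|//] := eqVneq z y.
    by move: zB; rewrite eq_zy (negPf (notyB _ yS)).
  by rewrite cardsDS //; have := cardsD1 y S; rewrite yS cS add1n => - [->].
have : \sum_(y in S) #|[set z in X :\: S | z \in B y]| <= #|X :\: S|.
  rewrite double_counting -sum1_card; apply: leq_sum => z; rewrite inE => /andP[zS zX].
  apply/card_le1_eqP => y y'; rewrite !inE => /andP[yS zB] /andP[y'S zB'].
  apply/eqP/contraT => ne_yy'.
  have [[BB sB] [BB' sB']] := (defB y yS, defB y' y'S).
  pose A' := z |: (S :\ y :\ y').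
  have sA' : A' \subset B y.
    by rewrite subUset sub1set zB (subset_trans (subsetDl _ _)).
  have sA'' : A' \subset B y'.
    by rewrite subUset sub1set zB' setDDl setUC -setDDl (subset_trans (subsetDl _ _)).
  have cA' : #|A'| = t.
    rewrite cardsU1 !inE (negPf zS) !andbF /=.
    have := cardsD1 y' (S :\ y); have := cardsD1 y S; rewrite yS cS !inE ne_yy' y'S /=.
    by rewrite !add1n => -[->] ->.
  have [sBX _] := blk _ BB.
  have eqB := steiner_uniq stX (subset_trans sA' sBX) cA' BB BB' sA' sA''.
  case/negP: (notyB _ yS); rewrite eqB; apply: (subsetP sB').
  by rewrite !inE eq_sym ne_yy'.
have := subset_leq_card sSX; rewrite (eq_bigr _ cBS) sum_nat_const cardsDS // cS => le_tX.
by rewrite leq_subRL // -mulnS.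
Qed.
End Steiner.

(** * Bounds on the parameters of perfect codes *)

Lemma cardsDC (T : finType) (X Y : {set T}) : #|X| = #|Y| -> #|X :\: Y| = #|Y :\: X|.
Proof. by move=> cXY; rewrite !cardsD cXY setIC. Qed.

(** Summing [card_cut2] over the possible intersection sizes; this regularity is what
an averaging argument over all sets of size [k] needs. *)
Lemma card_threshold (T : finType) (X X' : {set T}) k c : #|X| = #|X'| ->
  #|[set S : {set T} | (#|S| == k) && (c <= #|X :&: S|)]| =
  #|[set S : {set T} | (#|S| == k) && (c <= #|X' :&: S|)]|.
Proof.
have count (Z : {set T}) : #|[set S : {set T} | (#|S| == k) && (c <= #|Z :&: S|)]| =
    \sum_(i < k.+1 | c <= i) 'C(#|Z|, i) * 'C(#|T| - #|Z|, k - i).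
  rewrite -sum1_card.
  rewrite (partition_big (fun S => inord #|Z :&: S| : 'I_k.+1) (fun i : 'I_k.+1 => c <= i)) /=.
    apply: eq_bigr => i le_ci.
    have -> : #|T| - #|Z| = #|~: Z| by rewrite -(cardsC Z) addKn.
    rewrite -(@card_cut2 _ set0 Z (~: Z)) -?setI_eq0 ?set0I ?setICr //.
    rewrite -sum1_card; apply: eq_bigl => S; rewrite !inE setUCr setDT eqxx /= -setDE.
    have le_ZS : #|Z :&: S| <= #|S| by rewrite subset_leq_card ?subsetIr.
    have cS := cardsID Z S; rewrite setIC in cS; rewrite (setIC S Z).
    move: (ltn_ord i) => lt_ik.
    apply/andP/andP => [[/andP[/eqP cSk le_c] /eqP eqi]|[/eqP cZS /eqP cSZ]].
      have lt_ZSk : #|Z :&: S| < k.+1 by rewrite ltnS -cSk.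
      have := congr1 val eqi; rewrite /= inordK // => <-.
      by rewrite eqxx -cSk -cS addKn.
    have cSk : #|S| = k by rewrite -cS cZS cSZ subnKC.
    by rewrite cSk cZS eqxx le_ci inord_val.
  move=> S; rewrite inE => /andP[/eqP cS le_c].
  by rewrite inordK // ltnS -cS subset_leq_card ?subsetIr.
by rewrite !count => ->.
Qed.

Section PerfectBounds.
Variables (n w e : nat) (C : {set {set 'I_n}}).
Hypothesis perfC : perfect_code w e C.

(** If the distance is at most [2 e], moving half-way from [X] to [Y] gives a word in
both balls. *)
Lemma code_min_dist (X Y : {set 'I_n}) : X \in C -> Y \in C -> X != Y -> 2 * e < #|X :\: Y|.
Proof.
move=> XC YC; apply: contraNT; rewrite -leqNgt => le_d.
have [cX cY] := (code_card perfC XC, code_card perfC YC).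
have cYX : #|X :\: Y| = #|Y :\: X| by apply: cardsDC; rewrite cX cY.
set d := #|X :\: Y| in cYX le_d.
have [A sA cA] := exists_subset_card (geq_minr e d).
have [B sB cB] : exists2 B : {set 'I_n}, B \subset Y :\: X & #|B| = minn e d.
  by apply: exists_subset_card; rewrite -cYX geq_minr.
have [sAX dAY] : A \subset X /\ [disjoint A & Y] by move: sA; rewrite subsetD => /andP.
have [sBY dBX] : B \subset Y /\ [disjoint B & X] by move: sB; rewrite subsetD => /andP.
pose Z := X :\: A :|: B.
have cZ : #|Z| = w.
  rewrite cardsU (_ : _ :&: B = set0) ?cards0 ?subn0.
    by rewrite cardsDS // cX cA cB subnK // -cX -cA subset_leq_card.
  apply/eqP; rewrite setI_eq0 disjoint_sym; exact: disjointWr (subsetDl _ _) dBX.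
apply/eqP; apply: (perfect_unique perfC XC YC (Z := Z)); rewrite !inE cZ eqxx /jdist /=.
  apply: leq_trans (geq_minl e d); rewrite -cA; apply: subset_leq_card.
  by apply/subsetP=> x; rewrite !inE; do !case: (_ \in _).
apply: leq_trans (_ : #|(Y :\: X) :\: B| <= _); last first.
  by rewrite cardsDS // cB -cYX; lia.
apply/subset_leq_card/subsetP=> x; rewrite !inE negb_or negb_and negbK.
move=> /andP[/andP[/orP[xA|->] ->] xY]; last by rewrite xY.
by rewrite (disjointFr dAY xA) in xY.
Qed.

(** Roos' bound. For a [(w-2)]-set [S], the words that meet [S] in at least
[w - e - 1] points are pairwise at distance at most [2 e], so at most one of them
is a codeword. Averaging over [S], these words are at most as many as those in
a ball. For [S] inside a codeword [X], comparing them with the ball around [X]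
leaves only the words counted by two products of binomial coefficients. *)
Lemma roos_bound : C != set0 -> 0 < e -> 2 * e < w -> 2 * w <= n ->
  e * n <= (w - 1) * (2 * e + 1).
Proof.
move=> /set0Pn[X XC] e_gt0 lt_ew le_wn; have cX := code_card perfC XC.
have le_wn' : w <= n by lia.
pose c := w - e - 1.
have [S sSX cS] : exists2 S : {set 'I_n}, S \subset X & #|S| = w - 2.
  by apply: exists_subset_card; rewrite cX leq_subr.
pose r (Y S' : {set 'I_n}) := c <= #|Y :&: S'|.
pose F := [set Y in johnson n w | r Y S].
pose D := #|[set S' in johnson n (w - 2) | r X S']|.
have cD (Y : {set 'I_n}) : #|Y| = w -> #|[set S' in johnson n (w - 2) | r Y S']| = D.
  move=> cY; transitivity #|[set S' : {set 'I_n} | (#|S'| == w - 2) && (c <= #|Y :&: S'|)]|.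
    by apply: eq_card => S'; rewrite !inE.
  by rewrite (@card_threshold _ Y X) ?cY ?cX //; apply: eq_card => S'; rewrite !inE.
have cF (S' : {set 'I_n}) : #|S'| = w - 2 -> #|[set Y in johnson n w | r Y S']| = #|F|.
  move=> cS'; transitivity #|[set Y : {set 'I_n} | (#|Y| == w) && (c <= #|S' :&: Y|)]|.
    by apply: eq_card => Y; rewrite !inE /r setIC.
  rewrite (@card_threshold _ S' S) ?cS' ?cS //; apply: eq_card => Y.
  by rewrite !inE /r setIC.
have anticode (S' : {set 'I_n}) : #|S'| = w - 2 -> #|[set Y in C | r Y S']| <= 1.
  move=> cS'; apply/card_le1_eqP => Y Z; rewrite !inE => /andP[YC rY] /andP[ZC rZ].
  apply/eqP/contraT => /(code_min_dist ZC YC); rewrite /r in rY rZ.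
  have := cardsID Y Z; rewrite (code_card perfC ZC).
  have : #|Y :&: S' :&: (Z :&: S')| <= #|Z :&: Y|.
    by apply/subset_leq_card/subsetP=> x; rewrite !inE => /andP[/andP[-> _] /andP[-> _]].
  have : #|Y :&: S' :|: Z :&: S'| <= w - 2.
    by rewrite -cS' subset_leq_card // subUset !subsetIr.
  rewrite cardsU; move: rY rZ; rewrite /c.
  move: #|Y :&: S'| #|Z :&: S'| #|_ :&: (Z :&: S')| #|Z :&: Y| #|Z :\: Y| => a1 a2 a3 a4 a5.
  by clear -lt_ew e_gt0; lia.
(* Code-anticode bound: each word belongs to the same number D of translates of F. *)
have le_F : #|F| <= Phi e n w.
  have le_CD : #|C| * D <= 'C(n, w - 2).
    rewrite -card_johnson -sum_nat_const -sum1_card.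
    rewrite (eq_bigr (fun Y => #|[set S' in johnson n (w - 2) | r Y S']|)); last first.
      by move=> Y YC; rewrite cD // (code_card perfC YC).
    rewrite double_counting; apply: leq_sum => S'; rewrite in_johnson => /eqP.
    exact: anticode.
  have eq_F : 'C(n, w) * D = 'C(n, w - 2) * #|F|.
    rewrite -!card_johnson -!sum_nat_const.
    rewrite (eq_bigr (fun Y => #|[set S' in johnson n (w - 2) | r Y S']|)); last first.
      by move=> Y; rewrite in_johnson => /eqP/cD.
    by rewrite double_counting; apply: eq_bigr => S'; rewrite in_johnson => /eqP/cF.
  have C_gt0 : 0 < #|C| by rewrite card_gt0; apply/set0Pn; exists X.
  have bin_gt0' : 0 < 'C(n, w - 2) by rewrite bin_gt0; lia.
  rewrite -(leq_pmul2l C_gt0) (perfect_card perfC le_wn') -(leq_pmul2l bin_gt0').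
  by rewrite mulnCA -eq_F mulnCA mulnC leq_mul2r le_CD orbT.
have dSX : [disjoint S & ~: X] by rewrite -subsets_disjoint.
pose P := X :\: S.
have cP : #|P| = 2 by rewrite cardsDS // cX cS; lia.
have dPS : [disjoint P & S] by rewrite disjoint_sym disjoints_subset setCD subsetUr.
have dPX : [disjoint P & ~: X] by rewrite -subsets_disjoint subsetDl.
have cXC : #|~: X| = n - w by have := cardsC X; rewrite card_ord cX; lia.
have cut0 (Y : {set 'I_n}) : Y :\: (S :|: ~: X) = Y :&: P.
  by apply/setP=> x; rewrite !inE; do !case: (_ \in _).
have cutX (Y : {set 'I_n}) : #|Y :&: X| = #|Y :&: S| + #|Y :&: P|.
  rewrite -(cardsID S (Y :&: X)); congr (_ + _); apply: eq_card => x; rewrite !inE.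
    by have [xS|] := boolP (x \in S); rewrite ?andbF // (subsetP sSX x xS) !andbT.
  by do !case: (x \in _).
have le_FB : #|F :\: jball w e X| <= #|jball w e X :\: F|.
  have := cardsID (jball w e X) F; have := cardsID F (jball w e X).
  rewrite (card_jball _ le_wn') ?in_johnson ?cX // setIC; move: le_F; clear; lia.
have le1 : 'C(w - 2, c) * 'C(n - w, e.+1) <= #|F :\: jball w e X|.
  rewrite -cS -cXC -(@card_cut2 _ set0) -?setI_eq0 ?set0I //; last by rewrite setI_eq0.
  apply/subset_leq_card/subsetP=> Y; rewrite !inE cut0 /r => /and3P[/eqP cYP /eqP cYS /eqP cYX].
  have := cutX Y; rewrite cYP cYS cards0 addn0 => cYX'.
  have := cardsID X Y; rewrite cYX' setDE cYX => cY.
  have := cardsID Y X; rewrite setIC cYX' cX => cXY.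
  have cYw : #|Y| = w by rewrite -cY /c; clear -lt_ew e_gt0; lia.
  have dXY : jdist X Y = e.+1 by move: cXY; rewrite /jdist /c; clear -lt_ew e_gt0; lia.
  by rewrite leqnn cYw dXY eqxx ltnn.
have le2 : #|jball w e X :\: F| <= 'C(w - 2, w - e - 2) * 'C(n - w, e).
  rewrite -cS -cXC -(@card_cut2 _ P) //.
  apply/subset_leq_card/subsetP=> Y; rewrite !inE cut0 /r => /andP[+ /andP[/eqP cY le_d]].
  rewrite cY eqxx /= -ltnNge => lt_c.
  have := cutX Y; have := cardsID Y X; rewrite cX setIC -/(jdist X Y) => cXY cYX.
  have := cardsID X Y; rewrite setDE cY cYX => cY'.
  have le_P : #|Y :&: P| <= 2 by rewrite -cP subset_leq_card ?subsetIr.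
  have [h1 [h2 h3]] : #|Y :&: P| = 2 /\ #|Y :&: S| = w - e - 2 /\ #|Y :&: ~: X| = e.
    move: cXY cYX cY' le_P lt_c le_d; rewrite /c; clear -lt_ew e_gt0.
    move: #|Y :&: X| #|Y :&: S| #|Y :&: P| #|Y :&: ~: X| (jdist X Y) => a1 a2 a3 a4 a5.
    lia.
  by rewrite h2 h3 !eqxx !andbT eqEcard subsetIr cP h1.
have {le1 le2 le_FB} := leq_trans le1 (leq_trans le_FB le2).
have -> : 'C(w - 2, c) = 'C(w - 2, e - 1) by rewrite -bin_sub; [congr 'C(_, _)|]; rewrite /c; lia.
have -> : 'C(w - 2, w - e - 2) = 'C(w - 2, e) by rewrite -bin_sub; [congr 'C(_, _)|]; lia.
have binS : e * 'C(w - 2, e) = (w - 1 - e) * 'C(w - 2, e - 1).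
  have := mul_bin_left (w - 2) (e - 1); rewrite subn1 prednK // => ->.
  by congr (_ * _); lia.
have := mul_bin_left (n - w) e.
have : 0 < 'C(w - 2, e - 1) * 'C(n - w, e) by rewrite muln_gt0 !bin_gt0; lia.
move: 'C(w - 2, e - 1) 'C(w - 2, e) 'C(n - w, e) 'C(n - w, e.+1) binS => x y u z.
move=> def_y xu_gt0 def_z le_xz.
have : (e * (n - w - e)) * (x * u) <= ((w - 1 - e) * e.+1) * (x * u).
  have -> : (e * (n - w - e)) * (x * u) = e * x * ((n - w - e) * u) by lia.
  have -> : ((w - 1 - e) * e.+1) * (x * u) = e.+1 * u * ((w - 1 - e) * x) by lia.
  rewrite -def_y -def_z; have := leq_mul (leqnn (e * e.+1)) le_xz; lia.
rewrite leq_pmul2r //; clear -lt_ew le_wn.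
have [k ->] : exists k, n = w + e + k by exists (n - w - e); lia.
have [l ->] : exists l, w = l + e + 1 by exists (w - 1 - e); lia.
rewrite (_ : l + e + 1 + e + k - (l + e + 1) - e = k); last by lia.
rewrite (_ : l + e + 1 - 1 - e = l); last by lia.
by rewrite addnK; lia.
Qed.

(** Around a codeword [X], fix an [(e+1)]-set [B] outside [X]. For an [(e+1)]-subset [A]
of [X] the word [X :\: A :|: B] is at distance [e + 1] from [X]. The codeword [Y]
whose ball contains it must then be at distance exactly [2 e + 1] from [X], lose
all of [A] and contain [B]; conversely every such [Y] covers that word. Uniqueness of
[Y] is the Steiner property. *)
Lemma code_steiner (X B : {set 'I_n}) : X \in C -> B \subset ~: X -> #|B| = e.+1 ->
  steiner X e.+1 (2 * e + 1)
    [set X :\: Y | Y in [set Y in C | (#|X :\: Y| == 2 * e + 1) && (B \subset Y)]].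
Proof.
move=> XC sBX cB; have cX := code_card perfC XC.
split=> [P /imsetP[Y]|A sAX cA].
  by rewrite inE => /and3P[_ /eqP cY _] ->; rewrite subsetDl.
pose Z := X :\: A :|: B.
have dXB : [disjoint X & B] by rewrite disjoint_sym disjoints_subset.
have cZ : #|Z| = w.
  rewrite cardsU (_ : _ :&: B = set0) ?cards0 ?subn0.
    by rewrite cardsDS // cX cA cB subnK // -cX -cA subset_leq_card.
  by apply/eqP; rewrite setI_eq0; exact: disjointWl (subsetDl _ _) dXB.
have splitXY (Y : {set 'I_n}) : #|X :\: Y| = #|A :\: Y| + #|(X :\: A) :\: Y|.
  rewrite -(cardsID A (X :\: Y)); congr (_ + _); apply: eq_card => x; rewrite !inE.
    by have [xA|] := boolP (x \in A); rewrite ?andbF // (subsetP sAX x xA) !andbT.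
  by do !case: (_ \in _).
have splitZY (Y : {set 'I_n}) : #|Z :\: Y| = #|(X :\: A) :\: Y| + #|B :\: Y|.
  rewrite setDUl cardsU (_ : _ :&: _ = set0) ?cards0 ?subn0 //.
  apply/eqP; rewrite setI_eq0; apply: disjointWl (subsetDl _ _) _.
  exact: disjointWl (subsetDl _ _) (disjointWr (subsetDl _ _) dXB).
have far_iff (Y : {set 'I_n}) : Y \in C ->
    (#|Z :\: Y| <= e) =
    [&& #|X :\: Y| == 2 * e + 1, B \subset Y & A \subset X :\: Y].
  move=> YC; have cY := code_card perfC YC.
  rewrite subsetD sAX /= -setI_eq0 -(cards_eq0 (A :&: Y)) -setD_eq0 -(cards_eq0 (B :\: Y)).
  have cAY := cardsID Y A; rewrite cA in cAY.
  have [eqXY|neXY] := eqVneq X Y.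
    have cBX : #|B :\: X| = e.+1 by rewrite (setDidPl _) // disjoint_sym.
    rewrite -eqXY setDv cards0 (splitZY X) cBX addn1 /=; apply/negbTE.
    by rewrite -ltnNge addnS ltnS leq_addl.
  have := code_min_dist XC YC neXY.
  move: (splitXY Y) (splitZY Y) cAY.
  move: #|X :\: Y| #|A :\: Y| #|(X :\: A) :\: Y| #|Z :\: Y| #|B :\: Y| #|A :&: Y|.
  move=> a b c d f g; clear; move=> h1 h2 h3 h4.
  by apply/idP/and3P => [le_d|[/eqP h5 /eqP h6 /eqP h7]]; [split; apply/eqP|]; lia.
have ballE (Y : {set 'I_n}) : Y \in C -> (Z \in jball w e Y) = (#|Z :\: Y| <= e).
  move=> YC; rewrite !inE cZ eqxx /jdist /=; congr (_ <= _).
  by apply: cardsDC; rewrite cZ (code_card perfC YC).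
have [Y YC YZ] := perfect_cover perfC cZ.
have := YZ; rewrite ballE // far_iff // => /and3P[dXY sBY sAY].
rewrite -[RHS](cards1 (X :\: Y)); apply: eq_card => P; rewrite inE [RHS]inE.
apply/andP/eqP => [[/imsetP[Y' + ->] sAY']|->].
  rewrite inE => /and3P[Y'C dXY' sBY'].
  by rewrite (perfect_unique perfC YC Y'C YZ) // ballE // far_iff // dXY' sBY' sAY'.
by split=> //; apply/imsetP; exists Y => //; rewrite inE YC dXY sBY.
Qed.

End PerfectBounds.

Lemma bin3_mul6 m : 6 * 'C(m.+2, 3) = m.+2 * (m.+1 * m).
Proof.
by rewrite -[6]/(2 * 3) -mulnA -mul_bin_diag mulnCA -mul_bin_diag bin1.
Qed.

(** The first divisibility makes [w - e] equal to [q (e+1)], and Tits' bound gives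
[q >= e + 2]. For [q >= e + 3] the conclusion is a matter of size. For [q = e + 2]
it fails only if [4 <= e <= 8], and there the second divisibility is violated: it
would make [e + 3] a divisor of [(q (e+1) + 1) (q (e+1) + 2)], which is 12
modulo [e + 3]. *)
Lemma steiner_arith e w q l : 2 <= e -> e.+2 * e.+1 <= w ->
  q * e.+1 = w - e -> l * 'C(e + 3, 3) = 'C(w - e + 2, 3) ->
  16 * e - 29 <= w /\ 12 * e - 13 <= w.
Proof.
move=> le2e tits def_q def_l.
have def_w : w = e.+1 * q + e by nia.
have le_q : e + 2 <= q by nia.
have [lt_q|le_q'] := ltnP (e + 2) q.
  have le_w : e.+1 * (e + 3) + e <= w.
    by rewrite def_w leq_add2r leq_mul2l (leq_trans _ lt_q) ?orbT // addn3 addn2.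
  have : e = 2 \/ e = 3 \/ e = 4 \/ e = 5 \/ exists k, e = k + 6.
    have [lt_e6|le_6e] := ltnP e 6; first by clear -le2e lt_e6; lia.
    by do 4 right; exists (e - 6); rewrite subnK.
  move: le_w; clear; move=> le_w [|[|[|[|[k]]]]] def_e; rewrite {e}def_e in le_w *; split; lia.
have eq_q : q = e + 2 by lia.
have [e_small|e_large] := boolP (4 <= e <= 8); last first.
  have : e = 2 \/ e = 3 \/ exists k, e = k + 9.
    have [lt_e9|le_9e] := ltnP e 9; first by lia.
    by right; right; exists (e - 9); lia.
  by rewrite def_w eq_q => -[->|[->|[k ->]]]; split; lia.
have := congr1 (muln 6) def_l; rewrite mulnCA addn3 addn2 !bin3_mul6.
rewrite -def_q eq_q.
move: e e_small {le2e tits def_q def_l def_w le_q le_q' eq_q}.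
move=> [|[|[|[|[|[|[|[|[|e]]]]]]]]] //= _; lia.
Qed.

(** The Steiner system of [code_steiner] satisfies Tits' bound, and its divisibility
conditions for sets [U] of size [e] and [e - 2] feed [steiner_arith]. *)
Lemma perfect_weight_bound n w e (C : {set {set 'I_n}}) : perfect_code w e C ->
  C != set0 -> 2 <= e -> 2 * e + 1 < w -> 2 * w <= n ->
  16 * e - 29 <= w /\ 12 * e - 13 <= w.
Proof.
move=> perfC /set0Pn[X XC] le2e lt_ew le_wn; have cX := code_card perfC XC.
have cXC : #|~: X| = n - w by rewrite cardsCs setCK card_ord cX.
have [B sBX cB] : exists2 B : {set 'I_n}, B \subset ~: X & #|B| = e.+1.
  by apply: exists_subset_card; rewrite cXC; move: lt_ew le_wn; clear; lia.
have stX := code_steiner perfC XC sBX cB.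
have le_t : e.+1 <= 2 * e + 1 by move: le2e; clear; lia.
have := tits_bound stX le_t; rewrite cX => /(_ lt_ew).
rewrite (_ : 2 * e + 1 - e.+1 = e); last by clear; lia.
move=> tits.
have degree k : k <= e -> exists l, l * 'C(e + k.+1, k.+1) = 'C(w - e + k, k.+1).
  move=> le_ke; have [U sUX cU] : exists2 U : {set 'I_n}, U \subset X & #|U| = e - k.
    by apply: exists_subset_card; rewrite cX; move: lt_ew; clear; lia.
  have le_U : #|U| <= e.+1 by rewrite cU; clear; lia.
  have := steiner_degree stX sUX le_U; rewrite cX cU.
  rewrite (_ : 2 * e + 1 - (e - k) = e + k.+1); last by move: le_ke; clear; lia.
  rewrite (_ : w - (e - k) = w - e + k); last by move: le_ke lt_ew; clear; lia.
  rewrite (_ : e.+1 - (e - k) = k.+1); last by move: le_ke; clear; lia.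
  by eexists; eassumption.
have [q] := degree 0 isT; rewrite !bin1 addn0 addn1 => def_q.
have [l def_l] := degree 2 le2e.
exact: steiner_arith le2e tits def_q def_l.
Qed.

(** Two distinct codewords force [w >= 2 e + 1]. If [w = 2 e + 1], then Roos' bound
gives [n = 2 w], and two codewords, being disjoint, are complementary. *)
Lemma nontrivial_weight n w e (C : {set {set 'I_n}}) : perfect_code w e C ->
  0 < e -> 0 < w -> 2 * w <= n -> ~ trivial_code w e C ->
  C != set0 /\ 2 * e + 1 < w.
Proof.
move=> perfC e_gt0 w_gt0 le_wn notriv.
have [Z0 _ cZ0] : exists2 Z0 : {set 'I_n}, Z0 \subset setT & #|Z0| = w.
  by apply: exists_subset_card; rewrite cardsT card_ord; move: le_wn; clear; lia.
have [X XC _] := perfect_cover perfC cZ0; have cX := code_card perfC XC.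
have C_neq0 : C != set0 by apply/set0Pn; exists X.
split=> //.
have [Y YC neYX] : exists2 Y, Y \in C & Y != X.
  have [/existsP[Y /andP[YC neYX]]|] := boolP [exists Y, (Y \in C) && (Y != X)]; first by exists Y.
  rewrite negb_exists => /forallP C1; case: notriv; constructor 2.
  rewrite -[RHS](cards1 X); apply: eq_card => Y; rewrite [RHS]inE; apply/idP/eqP => [YC|-> //].
  by apply/eqP; have := C1 Y; rewrite YC negbK.
have far (Z : {set 'I_n}) : Z \in C -> Z != X -> 2 * e < #|X :\: Z|.
  by move=> ZC neZX; apply: (code_min_dist perfC) => //; rewrite eq_sym.
have lt_ew : 2 * e < w by rewrite -cX (leq_trans (far Y YC neYX)) // subset_leq_card ?subsetDl.
rewrite ltn_neqAle addn1 lt_ew andbT; apply/eqP => eq_w.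
have eq_n : n = 2 * w.
  have := roos_bound perfC C_neq0 e_gt0 lt_ew le_wn; rewrite -eq_w subn1 /=.
  rewrite (_ : 2 * e * _ = e * (2 * (2 * e).+1)) ?leq_pmul2l //; last by clear; lia.
  by move: le_wn; rewrite -eq_w; clear; lia.
have compl (Z : {set 'I_n}) : Z \in C -> Z != X -> Z = ~: X.
  move=> ZC neZX; have cXC : #|~: X| = w.
    by rewrite cardsCs setCK card_ord cX; move: eq_n; clear; lia.
  apply/eqP; rewrite eqEcard cXC (code_card perfC ZC) leqnn andbT.
  rewrite -disjoints_subset disjoint_sym -setI_eq0.
  rewrite -cards_eq0; have := cardsID Z X; have := far Z ZC neZX; rewrite cX -eq_w.
  by clear; lia.
case: notriv; constructor 3; split=> //; first by rewrite -eq_w addn1.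
exists X; first by rewrite in_johnson cX.
apply/setP=> Z; rewrite !inE; apply/idP/orP => [ZC|[/eqP->|/eqP->] //].
  by have [->|neZX] := eqVneq Z X; [left | right; apply/eqP/compl].
by rewrite -(compl Y).
Qed.

(** * Nonexistence of nontrivial perfect codes *)

Theorem theorem3p2 (n w e : nat) (hw : 2 <= 2 * w) (hn : 2 * w <= n)
    (he : 2 <= e)
    (hPhi : exists2 p, prime p & Phi e n w = 0 %[mod p ^ 2]) :
  ~ exists C : {set {set 'I_n}}, perfect_code w e C /\ ~ trivial_code w e C.
Proof.
case=> C [perfC notriv]; case: hPhi => p p_pr /eqP; rewrite mod0n -/(dvdn _ _) => dvdPhi.
have w_gt0 : 0 < w by move: hw; clear; lia.
have e_gt0 : 0 < e by apply: leq_trans he.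
have [C_neq0 lt_ew] := nontrivial_weight perfC e_gt0 w_gt0 hn notriv.
have [le1 le2] := perfect_weight_bound perfC C_neq0 he lt_ew hn.
have roos : e * n <= (w - 1) * (2 * e + 1).
  by apply: (roos_bound perfC) => //; move: lt_ew; clear; lia.
have p_gt1 := prime_gt1 p_pr.
pose s := trunc_log p w.
have [le_pw lt_wp] : p ^ s <= w /\ w < p ^ s.+1.
  by have /andP[] := trunc_log_bounds p_gt1 w_gt0.
(* Removing t points from a word clears all base-p digits of w but the leading one. *)
pose t := w %% p ^ s.
have ps_gt0 : 0 < p ^ s by rewrite expn_gt0 ltnW.
have lt_t : t < p ^ s by rewrite ltn_mod.
have dvd_wt : p ^ s %| w - t by rewrite /t {1}(divn_eq w (p ^ s)) addnK dvdn_mull.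
have le_ps : p ^ s <= w - t.
  apply: dvdn_leq dvd_wt; rewrite subn_gt0; exact: leq_trans lt_t le_pw.
have lt_tw : 2 * t < w by move: le_ps lt_t; clear; lia.
have [T _ cT] : exists2 T : {set 'I_n}, T \subset setT & #|T| = t.
  by apply: exists_subset_card; rewrite cardsT card_ord; move: lt_tw hn; clear; lia.
have dvd_bin : Phi e n w %| 'C(n - t, w - t).
  rewrite -(Phi_cover_count perfC (T := T)); first exact: dvdn_mulr.
  - by move: hn; clear; lia.
  - by move: lt_tw; clear; lia.
  - by move=> S cS; apply: (perfect_design perfC he hn le1 le2 lt_tw).
have bin_pos : 0 < 'C(n - t, w - t) by rewrite bin_gt0; move: hn; clear; lia.
have : 2 <= logn p 'C(n - t, w - t).
  by rewrite -pfactor_dvdn // (dvdn_trans dvdPhi).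
rewrite leqNgt ltnS => /negP; apply; apply: (@logn_bin_le1 p s) => //.
  by move: hn; clear; lia.
(* The rest shows n - t < p ^ s.+2, using n < 5/2 w from Roos' bound. *)
have lt_n : 2 * n < 5 * w.
  rewrite -(ltn_pmul2l e_gt0) mulnCA; apply: (@leq_ltn_trans ((w - 1) * (5 * e))).
    apply: leq_trans (leq_mul (leqnn 2) roos) _; rewrite mulnCA leq_mul2l.
    by apply/orP; right; move: he; clear; lia.
  by rewrite mulnA (mulnC e) ltn_pmul2r // mulnC ltn_pmul2l //; move: w_gt0; clear; lia.
have [d def_wt] : exists d, w - t = d * p ^ s by exists ((w - t) %/ p ^ s); rewrite divnK.
have lt_dp : d.+1 <= p.
  by rewrite -(ltn_pmul2r ps_gt0) -expnS -def_wt (leq_ltn_trans (leq_subr _ _)).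
have lt_nt : 2 * (n - t) < (5 * p - 2) * p ^ s.
  apply: (@leq_trans ((5 * d + 3) * p ^ s)).
    move: def_wt lt_t lt_n lt_tw; rewrite mulnDl -mulnA.
    by move: (d * p ^ s) (p ^ s) => x y; clear; lia.
  by rewrite leq_mul2r; apply/orP; right; move: lt_dp; clear; lia.
rewrite -(ltn_pmul2l (isT : 0 < 2)) (leq_trans lt_nt) // !expnS !mulnA leq_mul2r.
apply/orP; right; have [k ->] : exists k, p = k + 2 by exists (p - 2); rewrite subnK.
by clear; lia.
Qed.
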